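(* Let $0\le a<b<\infty$, and let $f:[a,b]\to\mathbb{R}$ be continuous on $[a,b]$ with $f\in L[a,b]$. Let $p,q>1$ be fixed. If $f$ belongs to the class $Q([a,b])$, then $$\int_a^b (x-a)^p(b-x)^q f(x)f(a+b-x)\,dx \le \frac{(b-a)^{p+q+1}}{2}\Big\{\big[f^2(a)+f^2(b)\big]\big(\beta(p+1,q-1)+\beta(p-1,q+1)\big)+4f(a)f(b)\,\beta(p,q)\Big\}.$$
   Context: A function $f:I\to\mathbb{R}$ on an interval $I$ belongs to the class $Q(I)$ if it is nonnegative and $f(\lambda x+(1-\lambda)y)\le \frac{f(x)}{\lambda}+\frac{f(y)}{1-\lambda}$ for all $x,y\in I$ and $\lambda\in(0,1)$. $\beta(m,n)=\int_0^1 t^{m-1}(1-t)^{n-1}\,dt$ for $m,n>0$ is the Euler Beta function. $f^2(x)$ denotes $(f(x))^2$. $L[a,b]$ denotes the integrable functions on $[a,b]$. *)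

(* Defs.v *)
From mathcomp Require Import all_boot all_order all_algebra.
From mathcomp Require Import all_classical all_reals all_analysis.
Import Order.TTheory GRing.Theory Num.Theory numFieldNormedType.Exports.
Set Implicit Arguments.
Unset Strict Implicit.
Unset Printing Implicit Defensive.
Local Open Scope classical_set_scope.
Local Open Scope ring_scope.

(* A function I -> R is represented by the values on I of a total function
   R -> R; the values outside I are never used. *)
Definition class_Q (R : realType) (I : interval R) (f : R -> R) : Prop :=
  (forall x, x \in I -> 0 <= f x) /\
  (forall x y l, x \in I -> y \in I -> 0 < l < 1 ->
     f (l * x + (1 - l) * y) <= f x / l + f y / (1 - l)).

(* The library's [beta_fun] only takes natural parameters. The integral below is
   finite exactly when 0 < m and 0 < n; otherwise [Rintegral] returns the
   default value 0. *)
Definition Beta (R : realType) (m n : R) : R :=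
  \int[@lebesgue_measure R]_(t in `[0, 1]) (t `^ (m - 1) * (1 - t) `^ (n - 1)).

(* Main.v *)
Require Import Defs.
From mathcomp Require Import all_boot all_order all_algebra.
From mathcomp Require Import all_classical all_reals all_analysis.
From mathcomp Require Import measurable_realfun ring lra.
Import Order.TTheory GRing.Theory Num.Theory numFieldNormedType.Exports.
Local Open Scope classical_set_scope.
Local Open Scope ring_scope.

(** Put [x = a + (b - a) * t], [A = f a] and [B = f b]. The class Q inequality
    gives [f x <= A / (1 - t) + B / t] and [f (a + b - x) <= A / t + B / (1 - t)];
    the product is bounded by half the sum of the squares, which, multiplied by
    [t `^ p * (1 - t) `^ q], integrates to the three Beta values. Since only
    [p, q > 1] is assumed, the majorant may be unbounded near 0 and 1, so its
    integrability comes from powers having bounded primitives. *)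

(** * Continuity within a set *)

Lemma within_continuous_comp_in {U V W : topologicalType} {A : set U}
    {B : set V} {f : U -> V} {g : V -> W} :
  f @` A `<=` B -> {within A, continuous f} -> {within B, continuous g} ->
  {within A, continuous (g \o f)}.
Proof.
move=> fAB /subspace_continuousP cf /subspace_continuousP cg.
apply/subspace_continuousP => x Ax.
apply: cvg_comp (cg _ (fAB _ (imageP _ Ax))) => Q /=.
rewrite /nbhs/= /within/= => BQ.
have := cf x Ax _ BQ; rewrite /nbhs /= /within /=.
by apply: filterS => y fy Ay; apply: fy => //; apply: fAB; exact: imageP.
Qed.

Lemma within_continuousM {T : topologicalType} {K : numFieldType}
    (A : set T) (f g : T -> K) :
  {within A, continuous f} -> {within A, continuous g} ->
  {within A, continuous (fun x => f x * g x)}.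
Proof. by move=> cf cg x; apply: cvgM; [exact: cf|exact: cg]. Qed.

(** The point 0 has to be included because [x - a] and [b - x] vanish at the ends of [[a, b]];
    [0 < r] makes the right limit there equal to the value 0. *)
Lemma within_continuous_powR {R : realType} (r : R) : 0 < r ->
  {within `[0, +oo[, continuous (@powR R ^~ r)}.
Proof.
move=> r0; apply/continuous_within_itvcyP; split; last first.
  by rewrite powR0 ?gt_eqF//; exact: powR_cvg0.
move=> x x0; apply/differentiable_continuous/derivable1_diffP.
exact: derivable_powR.
Qed.

(** * Affine change of variables to the unit interval *)

Lemma within_continuous_affine {R : realType} (G : R -> R) (a b : R) : a < b ->
  {within `[a, b], continuous G} ->
  {within `[0, 1], continuous (fun t => G (a + (b - a) * t))}.
Proof.
move=> ab cG; pose F t := a + (b - a) * t.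
have cF : continuous F.
  by move=> t; apply/differentiable_continuous/derivable1_diffP; exact: ex_derive.
apply: (within_continuous_comp_in (f := F) _ _ cG);
  last exact: continuous_subspaceT.
move=> x [t] /[swap] <- /=; rewrite !in_itv/= => /andP[t0 t1].
by rewrite /F; apply/andP; split; nra.
Qed.

Lemma Rintegral_affine {R : realType} (G : R -> R) (a b : R) : a < b ->
  {within `[a, b], continuous G} ->
  \int[@lebesgue_measure R]_(x in `[a, b]) G x =
  (b - a) * \int[@lebesgue_measure R]_(t in `[0, 1]) G (a + (b - a) * t).
Proof.
move=> ab cG; pose F t := a + (b - a) * t.
have dF (t : R) : is_derive t 1 F (b - a).
  rewrite /F; apply: is_derive_eq.
  by rewrite add0r mul1r /GRing.scale/= mulr1.
have DF : derive1 F = cst (b - a).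
  by apply/funext => t; rewrite derive1E derive_val.
have F0 : F 0 = a by rewrite /F mulr0 addr0.
have F1 : F 1 = b by rewrite /F mulr1 addrC subrK.
have cF : continuous F.
  by move=> t; apply/differentiable_continuous/derivable1_diffP; exact: ex_derive.
have := @integration_by_substitution_increasing R F G 0 1 ler01.
rewrite F0 F1 DF => E; rewrite [LHS]/Rintegral E => {E}//; last 5 first.
- by move=> x y _ _ xy; rewrite /F ltrD2l ltr_pM2l// subr_gt0.
- by move=> ? _; exact: cst_continuous.
- exact: is_cvg_cst.
- exact: is_cvg_cst.
- split.
  + by move=> t _; exact: ex_derive.
  + exact/cvg_at_right_filter/cF.
  + exact/cvg_at_left_filter/cF.
rewrite -RintegralZl//; last first.
  by apply: (@continuous_compact_integrable _ (G \o F));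
    [exact: segment_compact|exact: within_continuous_affine].
by apply: eq_Rintegral => t t01; rewrite !fctE mulrC.
Qed.

(** * Integrability of powers and Beta kernels through bounded primitives *)

Lemma integrable_bounded_primitive {R : realType} (F f : R -> R) (a b M : R) :
  measurable_fun `[a, b] f ->
  {in `]a, b[, forall x, 0 <= f x} -> {in `]a, b[, continuous f} ->
  {in `]a, b[, forall x : R, is_derive x 1 F (f x)} ->
  {in `]a, b[, forall x, `|F x| <= M} ->
  (@lebesgue_measure R).-integrable `[a, b] (EFin \o f).
Proof.
move=> mf f0 cf dF FM.
(* The closed intervals [D n] exhaust []a, b[]. On each of them the fundamental theorem of calculus
   bounds the integral of [f] by a constant, and monotone convergence carries this bound over to
   []a, b[]. *)
pose e n : R := n.+1%:R^-1; pose D n : set R := [set` `[a + e n, b - e n]].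
have e0 n : 0 < e n by rewrite invr_gt0.
have Dab n : D n `<=` `]a, b[.
  move=> x; rewrite /D/= !in_itv/= => /andP[ax xb].
  by have ? := e0 n; apply/andP; split; lra.
have nD : nondecreasing_seq D.
  move=> m n mn; rewrite subsetEset => x; rewrite /D/= !in_itv/= => /andP[ax xb].
  have : e n <= e m by rewrite lef_pV2 ?posrE// ler_nat ltnS.
  by move=> nm; apply/andP; split; lra.
have UD : \bigcup_n D n = `]a, b[%classic.
  apply/seteqP; split=> [x [n _ /Dab]//|x /=]; rewrite in_itv/= => /andP[ax xb].
  (* Choice of the index: [e n] is smaller than the distance from [x] to either end. *)
  have [|n] := @ltr_add_invr R 0 (Num.min (x - a) (b - x)).
    by rewrite lt_min !subr_gt0 ax.
  rewrite add0r -/(e n) lt_min => /andP[? ?]; exists n => //.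
  by rewrite /D/= in_itv/=; apply/andP; split; lra.
have mfo : measurable_fun `]a, b[ f.
  by apply: measurable_funS mf => //; exact: subset_itv_oo_cc.
have mD n : measurable (D n) by exact: measurable_itv.
(* For small [n] the set [D n] may be a point or empty. The bound uses the absolute value of [M]
   because nothing forces [0 <= M] when []a, b[] is empty. *)
have fD n : (\int[@lebesgue_measure R]_(x in D n) (f x)%:E <= (`|M| + `|M|)%:E)%E.
  rewrite /D; have [xy|] := ltP (a + e n) (b - e n); last first.
    rewrite le_eqVlt => /predU1P[->|yx].
      by rewrite set_itv1 integral_set1 lee_fin addr_ge0.
    by rewrite set_itv_ge ?integral_set0 ?lee_fin ?addr_ge0// bnd_simp -ltNge.
  have xD : (a + e n) \in `]a, b[ by apply: (Dab n); rewrite /D/= in_itv/= lexx ltW.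
  have yD : (b - e n) \in `]a, b[ by apply: (Dab n); rewrite /D/= in_itv/= lexx ltW.
  have cF x : x \in `]a, b[ -> {for x, continuous F}.
    move=> /dF ?; apply/differentiable_continuous/derivable1_diffP.
    exact: ex_derive.
  rewrite (@continuous_FTC2 _ f F)//.
  - rewrite -EFinB lee_fin (le_trans (ler_norm _))// (le_trans (ler_normB _ _))//.
    by rewrite lerD// (le_trans (FM _ _))// ler_norm.
  - apply: continuous_in_subspaceT => x; rewrite inE => /(Dab n).
    exact: cf.
  - split.
    + move=> x /subset_itv_oo_cc /(Dab n) /dF ?; exact: ex_derive.
    + exact/cvg_at_right_filter/cF.
    + exact/cvg_at_left_filter/cF.
  - move=> x /subset_itv_oo_cc /(Dab n) /dF ?.
    by rewrite derive1E derive_val.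
have fo : (\int[@lebesgue_measure R]_(x in `]a, b[) (f x)%:E <= (`|M| + `|M|)%:E)%E.
  have cvgD : (\int[@lebesgue_measure R]_(x in D n) (f x)%:E @[n --> \oo] -->
      \int[@lebesgue_measure R]_(x in `]a, b[) (f x)%:E)%E.
    rewrite -UD; apply: ge0_nondecreasing_set_cvg_integral => //.
    - move=> n; apply/measurable_EFinP; apply: measurable_funS mfo => //.
    - by move=> n x /Dab xab; rewrite lee_fin f0.
  rewrite -(cvg_lim _ cvgD)//; apply: lime_le; first exact: cvgP cvgD.
  by apply: nearW => n; exact: fD.
apply/integrableP; split; first exact/measurable_EFinP.
(* The two endpoints have measure zero, and the sign of [f] is known only between them. *)
rewrite integral_itv_bndoo; last by do 2 apply: measurableT_comp => //.
under eq_integral => x xab.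
  rewrite /= ger0_norm; last by apply: f0; rewrite inE in xab.
  over.
by rewrite (le_lt_trans fo)// ltry.
Qed.

Lemma powR_le1 {R : realType} (x r : R) : 0 <= x -> x <= 1 -> 0 <= r ->
  x `^ r <= 1.
Proof.
move=> x0 x1 r0; have := @ge0_ler_powR R r r0 x 1.
by rewrite powR1 !nnegrE; exact.
Qed.

(** Since [s + 1] is positive, the primitive used here stays between 0 and [(s + 1)^-1], even when
    the power itself blows up at 0. *)
Lemma integrable_powR01 {R : realType} (s : R) : -1 < s ->
  (@lebesgue_measure R).-integrable `[0, 1] (EFin \o (@powR R ^~ s)).
Proof.
move=> s1; have s0 : 0 < s + 1 by lra.
apply: (@integrable_bounded_primitive _
  (fun t => (s + 1)^-1 * t `^ (s + 1)) _ 0 1 (s + 1)^-1).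
- exact: measurable_funTS.
- by move=> x _; exact: powR_ge0.
- move=> x; rewrite in_itv/= => /andP[x0 _].
  apply/differentiable_continuous/derivable1_diffP.
  by apply: derivable_powR; rewrite in_itv/= x0.
- move=> x; rewrite in_itv/= => /andP[x0 _].
  have ? := @is_derive1_powR R (s + 1) _ x0.
  apply: is_derive_eq; rewrite addrK /GRing.scale/= mulrA mulVf ?mul1r//.
  by rewrite gt_eqF.
- move=> x; rewrite in_itv/= => /andP[x0 x1].
  rewrite ger0_norm ?mulr_ge0 ?powR_ge0 ?invr_ge0 ?(ltW s0)//.
  rewrite ler_piMr ?invr_ge0 ?(ltW s0)//.
  by apply: powR_le1; exact: ltW.
Qed.

Lemma is_derive1_onem_powR {R : realType} (r x : R) : x < 1 ->
  is_derive x 1 (fun t : R => (1 - t) `^ r) (- (r * (1 - x) `^ (r - 1))).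
Proof.
move=> x1; have x0 : 0 < 1 - x by rewrite subr_gt0.
have dB : is_derive x 1 (fun t : R => 1 - t) (-1).
  by apply: is_derive_eq; rewrite add0r mul1r.
have := @is_derive1_comp R (@powR R ^~ r) (fun t : R => 1 - t) x _ _
  (is_derive1_powR r x0) dB.
by rewrite mulrN1.
Qed.

Lemma integrable_powR01_onem {R : realType} (s : R) : -1 < s ->
  (@lebesgue_measure R).-integrable `[0, 1] (EFin \o (fun t => (1 - t) `^ s)).
Proof.
move=> s1; have s0 : 0 < s + 1 by lra.
apply: (@integrable_bounded_primitive _
  (fun t => - (s + 1)^-1 * (1 - t) `^ (s + 1)) _ 0 1 (s + 1)^-1).
- apply: measurable_funTS; apply: (measurableT_comp (measurable_powR s)).
  exact: measurable_funB.
- by move=> x _; exact: powR_ge0.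
- move=> x; rewrite in_itv/= => /andP[_ /(is_derive1_onem_powR s) ?].
  apply/differentiable_continuous/derivable1_diffP; exact: ex_derive.
- move=> x; rewrite in_itv/= => /andP[_ /(is_derive1_onem_powR (s + 1)) ?].
  apply: is_derive_eq; rewrite addrK /GRing.scale/= mulrNN mulrA mulVf ?mul1r//.
  by rewrite gt_eqF.
- move=> x; rewrite in_itv/= => /andP[x0 x1].
  rewrite mulNr normrN ger0_norm ?mulr_ge0 ?powR_ge0 ?invr_ge0 ?(ltW s0)//.
  rewrite ler_piMr ?invr_ge0 ?(ltW s0)//.
  by apply: powR_le1; lra.
Qed.

Definition beta_kernel {R : realType} (m n t : R) : R :=
  t `^ (m - 1) * (1 - t) `^ (n - 1).

Lemma measurable_beta_kernel {R : realType} (m n : R) :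
  measurable_fun [set: R] (beta_kernel m n).
Proof.
apply: measurable_funM; first exact: measurable_powR.
apply: (measurableT_comp (measurable_powR (n - 1))).
exact: measurable_funB.
Qed.

(** For [1 <= n] the factor in [1 - t] is at most 1, so the power of [t] alone dominates the kernel
    and the only possible singularity is at 0. *)
Lemma integrable_beta_kernel_ge1r {R : realType} (m n : R) : 0 < m -> 1 <= n ->
  (@lebesgue_measure R).-integrable `[0, 1] (EFin \o beta_kernel m n).
Proof.
move=> m0 n1; have ms : -1 < m - 1 by lra.
apply: le_integrable (integrable_powR01 _ ms) => //.
- by apply/measurable_EFinP/measurable_funTS; exact: measurable_beta_kernel.
- move=> t /=; rewrite in_itv/= => /andP[t0 t1]; rewrite lee_fin.
  rewrite !ger0_norm ?mulr_ge0 ?powR_ge0// ler_piMr ?powR_ge0//.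
  by apply: powR_le1; lra.
Qed.

Lemma integrable_beta_kernel_ge1l {R : realType} (m n : R) : 1 <= m -> 0 < n ->
  (@lebesgue_measure R).-integrable `[0, 1] (EFin \o beta_kernel m n).
Proof.
move=> m1 n0.
have ns : -1 < n - 1 by lra.
apply: le_integrable (integrable_powR01_onem _ ns) => //.
- by apply/measurable_EFinP/measurable_funTS; exact: measurable_beta_kernel.
- move=> t /=; rewrite in_itv/= => /andP[t0 t1]; rewrite lee_fin.
  rewrite !ger0_norm ?mulr_ge0 ?powR_ge0// ler_piMl ?powR_ge0//.
  by apply: powR_le1; lra.
Qed.

Lemma beta_kernel_ge0 {R : realType} (m n t : R) : 0 <= beta_kernel m n t.
Proof. by rewrite mulr_ge0 ?powR_ge0. Qed.

(** * Pointwise bound from the class Q inequality *)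

Lemma class_Q_mul_reflection_le {R : realType} (a b t : R) (f : R -> R) : a < b ->
  class_Q `[a, b] f -> 0 < t < 1 ->
  f (a + (b - a) * t) * f (a + b - (a + (b - a) * t)) <=
  ((f a ^+ 2 + f b ^+ 2) * (((1 - t) ^+ 2)^-1 + (t ^+ 2)^-1) +
   4 * f a * f b / (t * (1 - t))) / 2.
Proof.
move=> ab [f0 fQ] t01; have /andP[t0 t1] := t01.
have aI : a \in `[a, b] by rewrite in_itv/= lexx ltW.
have bI : b \in `[a, b] by rewrite in_itv/= lexx ltW.
(* The point and its reflection are the combinations of the endpoints with weights [t] and [1 - t],
   taken in the two orders. *)
have := fQ b a t bI aI t01; have := fQ a b t aI bI t01.
have -> : t * a + (1 - t) * b = a + b - (a + (b - a) * t) by ring.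
have -> : t * b + (1 - t) * a = a + (b - a) * t by ring.
set u := f (a + (b - a) * t); set v := f (_ - _) => hv hu.
have u0 : 0 <= u by apply: f0; rewrite in_itv/=; apply/andP; split; nra.
have v0 : 0 <= v by apply: f0; rewrite in_itv/=; apply/andP; split; nra.
apply: (le_trans (ler_pM u0 v0 hu hv)).
set P := _ + _; set Q := _ + _.
(* Each square contributes a cross term [2 * f a * f b / (t * (1 - t))], whence the coefficient
   4. *)
have -> : ((f a ^+ 2 + f b ^+ 2) * (((1 - t) ^+ 2)^-1 + (t ^+ 2)^-1) +
   4 * f a * f b / (t * (1 - t))) / 2 = (P ^+ 2 + Q ^+ 2) / 2.
  by rewrite /P /Q; field; apply/andP; split; lra.
by have := sqr_ge0 (P - Q); rewrite sqrrB; lra.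
Qed.

(** * Integration of the pointwise bound *)

Theorem theorem4 (R : realType) (a b : R) (f : R -> R) (p q : R)
  (ha : 0 <= a) (hab : a < b)
  (hcont : {within `[a, b], continuous f})
  (hint : (@lebesgue_measure R).-integrable `[a, b] (EFin \o f))
  (hp : 1 < p) (hq : 1 < q)
  (hQ : class_Q `[a, b] f) :
  \int[@lebesgue_measure R]_(x in `[a, b])
     ((x - a) `^ p * (b - x) `^ q * f x * f (a + b - x))
  <= (b - a) `^ (p + q + 1) / 2 *
     ((f a ^+ 2 + f b ^+ 2) * (Beta (p + 1) (q - 1) + Beta (p - 1) (q + 1))
      + 4 * f a * f b * Beta p q).
Proof.
pose L := b - a; pose C := f a ^+ 2 + f b ^+ 2; pose D := 4 * f a * f b.
have L0 : 0 < L by rewrite subr_gt0.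
have fa0 : 0 <= f a by apply: hQ.1; rewrite in_itv/= lexx ltW.
have fb0 : 0 <= f b by apply: hQ.1; rewrite in_itv/= lexx ltW.
(* Dividing the weight with exponents [p] and [q] by [(1 - t) ^+ 2], [t ^+ 2] and [t * (1 - t)]
   gives these three kernels in turn. *)
pose H t := C * (beta_kernel (p + 1) (q - 1) t + beta_kernel (p - 1) (q + 1) t)
  + D * beta_kernel p q t.
pose int01 (g : R -> R) := (@lebesgue_measure R).-integrable `[0, 1] (EFin \o g).
have int01D g h : int01 g -> int01 h -> int01 (fun t => g t + h t).
  by move=> ig ih; apply: (integrableD _ ig ih); exact: measurable_itv.
have int01Z k g : int01 g -> int01 (fun t => k * g t).
  by move=> ig; apply: (integrableZl _ k ig); exact: measurable_itv.
(* Every kernel has a parameter above 1; the other may be [q - 1] or [p - 1], known only to be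
   positive. *)
have i1 : int01 (beta_kernel (p + 1) (q - 1)).
  by apply: integrable_beta_kernel_ge1l; lra.
have i2 : int01 (beta_kernel (p - 1) (q + 1)).
  by apply: integrable_beta_kernel_ge1r; lra.
have i3 : int01 (beta_kernel p q).
  by apply: integrable_beta_kernel_ge1r; lra.
have i12 := int01Z C _ (int01D _ _ i1 i2).
have iH : int01 H := int01D _ _ i12 (int01Z D _ i3).
have HE : \int[@lebesgue_measure R]_(t in `[0, 1]) H t =
    C * (Beta (p + 1) (q - 1) + Beta (p - 1) (q + 1)) + D * Beta p q.
  rewrite RintegralD//; last exact: int01Z.
  by rewrite !RintegralZl// ?RintegralD//; exact: int01D.
pose G x := (x - a) `^ p * (b - x) `^ q * f x * f (a + b - x).
have cG : {within `[a, b], continuous G}.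
  have pos x : x \in `[a, b] -> 0 <= x - a /\ 0 <= b - x.
    by rewrite in_itv/= => /andP[? ?]; split; lra.
  have cr (g : R -> R) r : 0 < r -> continuous g ->
      (forall x, x \in `[a, b] -> 0 <= g x) ->
      {within `[a, b], continuous (fun x => g x `^ r)}.
    move=> r0 cg g0.
    apply: (within_continuous_comp_in _ _ (within_continuous_powR _ r0)).
    - by move=> y [x] /[swap] <- /= xab; rewrite in_itv/= andbT g0.
    - exact: continuous_subspaceT.
  apply: within_continuousM;
    first (apply: within_continuousM; first apply: within_continuousM).
  - apply: cr; [lra| |by move=> x /pos[]].
    by move=> x; apply: cvgB; [exact: cvg_id|exact: cvg_cst].
  - apply: cr; [lra| |by move=> x /pos[]].
    by move=> x; apply: cvgB; [exact: cvg_cst|exact: cvg_id].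
  - exact: hcont.
  - apply: (within_continuous_comp_in (f := fun x => a + b - x) _ _ hcont).
    + move=> y [x] /[swap] <- /= /pos[? ?].
      by rewrite in_itv/=; apply/andP; split; lra.
    + apply: continuous_subspaceT => x.
      by apply: cvgB; [exact: cvg_cst|exact: cvg_id].
(* The factor [L] leaves both powers, giving the exponent [p + q]; the 2 comes from the mean of the
   two squares. *)
have GH t : t \in `[0, 1] -> G (a + L * t) <= L `^ (p + q) / 2 * H t.
  rewrite in_itv/= => /andP[t0 t1].
  have H0 : 0 <= H t.
    by rewrite addr_ge0// mulr_ge0// ?addr_ge0 ?beta_kernel_ge0 ?mulr_ge0 ?sqr_ge0.
  have -> : G (a + L * t) = (L * t) `^ p * (L * (1 - t)) `^ q *
      f (a + (b - a) * t) * f (a + b - (a + (b - a) * t)).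
    by rewrite /G -/L; congr (_ `^ p * _ `^ q * _ * _); rewrite /L; ring.
  have LH0 : 0 <= L `^ (p + q) / 2 * H t by rewrite mulr_ge0 ?divr_ge0 ?powR_ge0.
  (* The class Q bound needs [0 < t < 1]. At the endpoints the left side is 0, as [p] and [q] are
     nonzero, and the right side is nonnegative. *)
  have [tE|tn0] := eqVneq t 0.
    have -> : L * t = 0 by rewrite tE mulr0.
    by rewrite powR0 ?mul0r//; apply/eqP; lra.
  have [tE|tn1] := eqVneq t 1.
    have -> : L * (1 - t) = 0 by rewrite tE subrr mulr0.
    by rewrite (powR0 (x := q)) ?mulr0 ?mul0r//; apply/eqP; lra.
  have t0' : 0 < t by rewrite lt_def tn0.
  have t1' : 0 < 1 - t by rewrite subr_gt0 lt_def eq_sym tn1.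
  have t01 : 0 < t < 1 by rewrite t0' -subr_gt0.
  rewrite !powRM ?(ltW L0) ?(ltW t0') ?(ltW t1')//.
  have -> : L `^ (p + q) / 2 * H t = L `^ p * t `^ p * (L `^ q * (1 - t) `^ q) *
      ((C * (((1 - t) ^+ 2)^-1 + (t ^+ 2)^-1) + D / (t * (1 - t))) / 2).
    rewrite powRD ?(gt_eqF L0) ?implybT// /H /beta_kernel !addrK.
    rewrite !powRB ?(gt_eqF t0') ?(gt_eqF t1') ?implybT// !powRr1 ?(ltW t0') ?(ltW t1')//.
    by field; apply/andP; split; lra.
  rewrite -mulrA ler_wpM2l ?mulr_ge0 ?powR_ge0//.
  exact: class_Q_mul_reflection_le.
rewrite (Rintegral_affine G)// -/L -/C -/D -HE.
(* The additional factor [L] is the Jacobian of the change of variables. *)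
have -> : L `^ (p + q + 1) = L * L `^ (p + q).
  by rewrite powRD ?(gt_eqF L0) ?implybT// powRr1 ?(ltW L0)// mulrC.
rewrite -!mulrA ler_pM2l// mulrA -RintegralZl//.
(* Monotonicity requires both sides integrable: the left by continuity on a compact interval, the
   right, possibly unbounded, by [iH]. *)
apply: le_Rintegral => //; last exact: int01Z.
apply: continuous_compact_integrable; first exact: segment_compact.
exact: within_continuous_affine.
Qed.
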